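(* Let $W$ be the Weyl group of a Kac-Moody algebra attached to a generalized Cartan matrix $A=(a_{ij})_{1\le i,j\le r}$, with simple reflections $r_1,\dots,r_r$ and simple roots $\alpha_1,\dots,\alpha_r$, and let $\{\psi^w\}_{w\in W}$ be the family of functions $\psi^w:W\to R[T]$ characterized in the context. Let $v\in W$, let $v=r_{i_1}\cdots r_{i_l}$ be a reduced decomposition of $v$ (so $l=l(v)$), and for $1\le j\le l$ put $\beta_j=r_{i_1}\cdots r_{i_{j-1}}\alpha_{i_j}$. If $w\in W$ satisfies $w\le v$ (Bruhat order), then $$\psi^{w}(v)=e^{\rho-v\rho}\sum_{l(w)\le m\le l(v)}\ \sum\ (e^{-\beta_{j_1}}-1)\cdots(e^{-\beta_{j_m}}-1),$$ where the second sum runs over all integers $1\le j_1<\cdots<j_m\le l$ such that $\underline{r}_{i_{j_1}}\cdots\underline{r}_{i_{j_m}}=\underline{w}$ in the monoid $\underline{W}$.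
   Context: Root data. $A=(a_{ij})_{1\le i,j\le r}$ is a generalized Cartan matrix: $a_{ii}=2$, $-a_{ij}\in\mathbb N$ for $i\ne j$, and $a_{ij}=0$ iff $a_{ji}=0$. $\mathfrak h$ is a complex vector space of dimension $2r-\mathrm{rank}(A)$ with linearly independent families $\{\alpha_i\}_{1\le i\le r}\subset\mathfrak h^*$ (simple roots) and $\{h_i\}_{1\le i\le r}\subset\mathfrak h$ such that $\alpha_j(h_i)=a_{ij}$. The Weyl group $W\subset\mathrm{Aut}(\mathfrak h^* )$ is generated by the simple reflections $r_i(\lambda)=\lambda-\lambda(h_i)\alpha_i$; it is a Coxeter group with length $l$, Bruhat order $\le$, and neutral element $1$. $\Delta_+$ is the set of positive roots of the associated Kac-Moody algebra, $\Delta_-=-\Delta_+$, and $\Delta(w)=\Delta_+\cap w^{-1}\Delta_-$. A lattice $\mathfrak h_{\mathbb Z}\subset\mathfrak h$ is fixed with $\mathfrak h_{\mathbb Z}\otimes_{\mathbb Z}\mathbb C=\mathfrak h$, $h_i\in\mathfrak h_{\mathbb Z}$ for all $i$, $\mathfrak h_{\mathbb Z}/\sum_i\mathbb Z h_i$ torsion free, and $\alpha_i\in\mathfrak h_{\mathbb Z}^*=\mathrm{Hom}(\mathfrak h_{\mathbb Z},\mathbb Z)$ for all $i$. One chooses $\rho_i\in\mathfrak h_{\mathbb Z}^*$ with $\rho_i(h_j)=\delta_{ij}$ and puts $\rho=\sum_{i=1}^r\rho_i$. Rings and operators. $R[T]=\mathbb Z[X[T]]$ is the group ring of the character group $X[T]$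 of the torus $T$ (i.e. of the lattice $\mathfrak h_{\mathbb Z}^*$), with $e^\lambda$ the element attached to $\lambda\in\mathfrak h_{\mathbb Z}^*$; $Q[T]$ is its fraction field. $F(W,R[T])$ and $F(W,Q[T])$ are the algebras of functions on $W$ with values in $R[T]$, resp. $Q[T]$, with pointwise operations. For $1\le i\le r$ the Demazure operator $D_i$ on $F(W,Q[T])$ is $$(D_if)(v)=\frac{f(v)-f(vr_i)e^{-v\alpha_i}}{1-e^{-v\alpha_i}}.$$ The functions $\psi^w$. By a theorem of Kostant and Kumar there is a family $\{\psi^w\}_{w\in W}\subset F(W,R[T])$ characterized by: (i) $\psi^w(v)=0$ unless $w\le v$; (ii) $\psi^w(w)=\prod_{\beta\in\Delta(w^{-1})}(1-e^\beta)$; (iii) $D_i\psi^w=\psi^w+\psi^{wr_i}$ if $wr_i<w$, and $D_i\psi^w=0$ if $wr_i>w$; (iv) $\psi^1(v)=e^{\rho-v\rho}$ for all $v\in W$. (They are the restrictions to the $T$-fixed points of a basis of the $T$-equivariant $K$-theory of the flag variety $G/B$.) The monoid $\underline W$. $\underline W$ is the monoid generated by $\underline r_1,\dots,\underline r_r$ subject to $\underline r_i^2=\underline r_i$ and to the same braid relations as the $r_i$ in $W$. As a set it is identified with $W$: $w\in W$ corresponds to $\underline w=\underline r_{k_1}\cdots\underline r_{k_n}$ for any reduced decomposition $w=r_{k_1}\cdots r_{k_n}$. (The empty product is $\underline 1$.) *)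

(* Defs.v *)
From HB Require Import structures.
From mathcomp Require Import all_boot all_order all_algebra.
From mathcomp Require Import generic_quotient fraction.
From mathcomp Require Import boolp classical_sets fsbigop reals complex.
From mathcomp Require Import finmap monalg.
From Stdlib Require Import Relation_Operators.

Set Implicit Arguments.
Unset Strict Implicit.
Unset Printing Implicit Defensive.

Import Order.TTheory GRing.Theory Num.Theory.
Local Open Scope ring_scope.
Local Open Scope quotient_scope.
Local Open Scope complex_scope.

(* multinomials equips [{malg int[K]}] with a product only when the monoid [K]
   has no nontrivial units, so the convolution product is defined here. *)
Definition group_ring (G : zmodType) : Type := {malg int[G]}.

HB.instance Definition _ (G : zmodType) :=
  GRing.Zmodule.copy (group_ring G) {malg int[G]}.

Section GroupRing.
Variable G : zmodType.
Implicit Types (f g : group_ring G) (a b : G).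

(* The basis element e^a. *)
Definition gexp a : group_ring G := mkmalgU a 1.

Definition gmul f g : group_ring G :=
  \sum_(a <- msupp f) \sum_(b <- msupp g) mkmalgU (a + b) (f@_a * g@_b).

Lemma gmulw (d1 d2 : {fset G}) f g :
    (msupp f `<=` d1)%fset -> (msupp g `<=` d2)%fset ->
  gmul f g = \sum_(a <- d1) \sum_(b <- d2) mkmalgU (a + b) (f@_a * g@_b).
Proof.
move=> le_d1 le_d2; rewrite /gmul (big_fset_incl _ le_d1) /=.
  apply/eq_bigr=> a _; apply/big_fset_incl => // b _ /mcoeff_outdom ->.
  by rewrite mulr0 monalgU0.
move=> a _ /mcoeff_outdom fa.
by rewrite big1 // => b _; rewrite fa mul0r monalgU0.
Qed.

Lemma gmulC : commutative gmul.
Proof.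
move=> f g; rewrite /gmul exchange_big /=.
by apply: eq_bigr => a _; apply: eq_bigr => b _; rewrite mulrC addrC.
Qed.

Lemma gmulDl : left_distributive gmul +%R.
Proof.
move=> f g k.
have sf : (msupp f `<=` msupp f `|` msupp g)%fset by apply: fsubsetUl.
have sg : (msupp g `<=` msupp f `|` msupp g)%fset by apply: fsubsetUr.
rewrite (gmulw (msuppD_le f g) (fsubset_refl _)).
rewrite (gmulw sf (fsubset_refl _)) (gmulw sg (fsubset_refl _)).
rewrite -big_split /=; apply: eq_bigr => a _.
rewrite -big_split /=; apply: eq_bigr => b _.
by rewrite mcoeffD mulrDl monalgUD.
Qed.

Lemma gmul0g : left_zero (0 : group_ring G) gmul.
Proof. by move=> g; rewrite /gmul msupp0 big_seq_fset0. Qed.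

Lemma gmulUU a b (x y : int) :
  gmul (mkmalgU a x) (mkmalgU b y) = mkmalgU (a + b) (x * y).
Proof.
by rewrite (gmulw msuppU_le msuppU_le) !big_seq_fset1 !mcoeffUU.
Qed.

Lemma gmul_sumr (I : Type) (s : seq I) (F : I -> group_ring G) f :
  gmul f (\sum_(i <- s) F i) = \sum_(i <- s) gmul f (F i).
Proof.
have h x y : gmul f (x + y) = gmul f x + gmul f y by rewrite !(gmulC f) gmulDl.
have h0 : gmul f 0 = 0 by rewrite gmulC gmul0g.
exact: (big_morph (gmul f) h h0).
Qed.

Lemma gmul_suml (I : Type) (s : seq I) (F : I -> group_ring G) f :
  gmul (\sum_(i <- s) F i) f = \sum_(i <- s) gmul (F i) f.
Proof. by rewrite gmulC gmul_sumr; apply: eq_bigr => i _; rewrite gmulC. Qed.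

Lemma gmulA : associative gmul.
Proof.
move=> f g k; rewrite (monalgE f) (monalgE g) (monalgE k).
rewrite [LHS]gmul_suml [X in _ = gmul X _]gmul_suml [RHS]gmul_suml.
apply: eq_bigr => a _.
rewrite [X in gmul _ X = _]gmul_suml [LHS]gmul_sumr.
rewrite [X in _ = gmul X _]gmul_sumr [RHS]gmul_suml.
apply: eq_bigr => b _.
rewrite [X in gmul _ X = _]gmul_sumr [LHS]gmul_sumr [RHS]gmul_sumr.
apply: eq_bigr => c _.
by rewrite !gmulUU addrA mulrA.
Qed.

Lemma gmul1g : left_id (gexp 0) gmul.
Proof.
move=> g; rewrite [in LHS](monalgE g) gmul_sumr [RHS]monalgE.
by apply: eq_bigr => a _; rewrite gmulUU add0r mul1r.
Qed.

Lemma gexp0_neq0 : gexp 0 != 0.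
Proof. by rewrite monalgU_eq0 oner_eq0. Qed.

End GroupRing.

HB.instance Definition _ (G : zmodType) :=
  GRing.Zmodule_isComNzRing.Build (group_ring G)
    (@gmulA G) (@gmulC G) (@gmul1g G) (@gmulDl G) (@gexp0_neq0 G).

(* Units are only added so that the group ring can become an [idomainType]. *)
Section GroupRingUnit.
Variable G : zmodType.
Implicit Types f g : group_ring G.

Definition gunit : pred (group_ring G) := fun f => `[< exists g, g * f = 1 >].

Definition ginv f : group_ring G :=
  if pselect (exists g, g * f = 1) is left ex then sval (cid ex) else f.

Lemma gmulVg : {in gunit, left_inverse 1 ginv *%R}.
Proof.
move=> f; rewrite unfold_in => /asboolP ex; rewrite /ginv.
by case: pselect => // ex'; case: cid.
Qed.

Lemma gunitP f g : g * f = 1 -> gunit f.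
Proof. by move=> h; apply/asboolP; exists g. Qed.

Lemma ginv_out : {in [predC gunit], ginv =1 id}.
Proof.
move=> f; rewrite inE unfold_in => /asboolPn nex; rewrite /ginv.
by case: pselect.
Qed.

End GroupRingUnit.

HB.instance Definition _ (G : zmodType) :=
  GRing.ComNzRing_hasMulInverse.Build (group_ring G)
    (@gmulVg G) (@gunitP G) (@ginv_out G).

(* Z[G] is an integral domain as soon as G embeds in some Z^n. *)
Section GroupRingDomain.
Variables (G : zmodType) (n : nat) (c : G -> 'I_n -> int).
Hypothesis cD : forall a b i, c (a + b) i = c a i + c b i.
Hypothesis c_inj : forall a b, (forall i, c a i = c b i) -> a = b.
Implicit Types (a b : G).

Let lt a b : Prop :=
  exists i : 'I_n, (forall j : 'I_n, (j < i)%N -> c a j = c b j) /\ c a i < c b i.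

Let lt_total a b : a <> b -> lt a b \/ lt b a.
Proof.
move=> neq.
have [i0 ci0] : exists i, c a i != c b i.
  apply: contrapT => h; apply: neq; apply: c_inj => i; apply/eqP.
  by apply: contrapT => /negP hi; apply: h; exists i.
have [i ci imin] :=
  @arg_minnP _ i0 (fun i => c a i != c b i) (fun i : 'I_n => i : nat) ci0.
have eqj (j : 'I_n) : (j < i)%N -> c a j = c b j.
  move=> ji; apply/eqP; apply: contraTT ji => /imin; rewrite leqNgt.
  by [].
have [lti|lti|e] := ltgtP (c a i) (c b i).
- by left; exists i.
- by right; exists i; split=> // j /eqj.
- by rewrite e eqxx in ci.
Qed.

Let lt_irr a : ~ lt a a.
Proof. by case=> i [_]; rewrite ltxx. Qed.

Let lt_trans b a d : lt a b -> lt b d -> lt a d.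
Proof.
case=> i [ei li] [j [ej lj]].
have [ij|ji|e] := ltngtP i j.
- exists i; split=> [k ki|]; last by rewrite -ej.
  by rewrite ei // ej // (ltn_trans ki).
- exists j; split=> [k kj|]; last by rewrite ei.
  by rewrite ei ?ej // (ltn_trans kj).
- have e' : i = j by apply: val_inj.
  subst j; exists i; split=> [k ki|]; first by rewrite ei ?ej.
  exact: Order.POrderTheory.lt_trans li lj.
Qed.

Let lt_add2 a b d : lt a b -> lt (a + d) (b + d).
Proof.
case=> i [ei li]; exists i; split=> [k ki|]; first by rewrite !cD ei.
by rewrite !cD ltrD2r.
Qed.

Let max_ex (s : seq G) : s != [::] ->
  exists2 m, m \in s & forall a, a \in s -> a = m \/ lt a m.
Proof.
elim: s => // a [|b s] IH _.
  by exists a; rewrite ?inE // => x; rewrite inE => /eqP; left.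
case: (IH isT) => m ms hm.
case: (EM (a = m)) => [am|/lt_total[am|ma]].
- by exists m => [|x]; rewrite inE ?ms ?orbT // => /predU1P[->|/hm//]; left.
- by exists m => [|x]; rewrite inE ?ms ?orbT // => /predU1P[->|/hm//]; right.
- exists a => [|x]; rewrite inE ?eqxx // => /predU1P[->|/hm]; first by left.
  by case=> [->|xm]; right=> //; apply: lt_trans ma.
Qed.

Lemma group_ring_integral (f g : group_ring G) :
  f * g = 0 -> (f == 0) || (g == 0).
Proof.
move=> fg0; apply/norP => -[f0 g0].
have supp_neq0 (h : group_ring G) : h != 0 -> (msupp h : seq G) != [::].
  apply: contra_neq => h0; rewrite (monalgE h); rewrite h0; exact: big_nil.
have [p pf pmax] := max_ex (supp_neq0 _ f0).
have [q qg qmax] := max_ex (supp_neq0 _ g0).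
have : (f * g : {malg int[G]})@_(p + q) = f@_p * g@_q.
  rewrite raddf_sum (big_fsetD1 p) //= raddf_sum (big_fsetD1 q) //=.
  rewrite mcoeffU eqxx mulr1n !big1_fset ?addr0 //.
    move=> a; rewrite in_fsetD1 => /andP[/eqP ap af] _.
    rewrite raddf_sum big1_fset //= => b bg _; rewrite mcoeffU.
    case: eqP => // e; case: (pmax _ af) => // lap; exfalso.
    case: (qmax _ bg) => [bq|lbq].
      by apply: ap; apply: (addIr q); rewrite -e bq.
    apply: (@lt_irr (p + q)); rewrite -{1}e.
    apply: (@lt_trans (p + b)); first exact: lt_add2.
    by rewrite ![p + _]addrC; apply: lt_add2.
  move=> b; rewrite in_fsetD1 => /andP[/eqP bq bg] _.
  by rewrite mcoeffU; case: eqP => // /addrI.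
rewrite fg0 mcoeff0 => /esym/eqP; rewrite mulf_eq0 !mcoeff_eq0.
by rewrite pf qg.
Qed.

End GroupRingDomain.

Lemma lfun_inv_unique (K : fieldType) (V : vectType K) (f g : 'End(V)) :
  (f \o g = \1)%VF -> (g \o f = \1)%VF -> (f^-1)%VF = g.
Proof.
move=> fg gf; have k0 : lker f == 0%VS.
  apply/lker0P => x y fxy.
  by have := congr1 g fxy; rewrite -!comp_lfunE gf !id_lfunE.
by rewrite -[LHS]comp_lfun1r -fg comp_lfunA lker0_compVf // comp_lfun1l.
Qed.

Definition is_gcm (r : nat) (A : 'M[int]_r) : Prop :=
  [/\ forall i, A i i = 2,
      forall i j, i != j -> A i j <= 0
    & forall i j, A i j = 0 <-> A j i = 0].

Definition is_integer (R : realType) (c : R[i]) : Prop :=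
  exists m : int, c = m%:~R.

(* [hT] is h, with its simple roots and coroots; [hZ] is the lattice h_Z.
   That h_Z is a lattice with h_Z (x) C = h means that it is the Z-span of some
   C-basis of h.  Hom(h_Z, Z) is identified with the set of the linear forms on
   h that take integer values on h_Z. *)
Record root_data (R : realType) (r : nat) (A : 'M[int]_r) := RootData {
  gcm : is_gcm A;
  hT : vectType R[i];
  hT_dim : \dim {:hT} = (2 * r - \rank (map_mx intr A : 'M[R[i]]_r))%N;
  alpha : 'I_r -> 'Hom(hT, (R[i])^o);
  coroot : 'I_r -> hT;
  alpha_free : free [seq alpha i | i <- enum 'I_r];
  coroot_free : free [seq coroot i | i <- enum 'I_r];
  alpha_coroot : forall i j, alpha j (coroot i) = (A i j)%:~R;
  hZ : set hT;
  hZ_lattice : exists e : (\dim {:hT}).-tuple hT, basis_of fullv e /\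
    forall x, hZ x <->
      exists m : 'I_(\dim {:hT}) -> int, x = \sum_k tnth e k *~ m k;
  hZ_coroot : forall i, hZ (coroot i);
  hZ_torsion_free : forall x (k : int), hZ x -> k != 0 ->
    (exists m : 'I_r -> int, x *~ k = \sum_i coroot i *~ m i) ->
    exists m : 'I_r -> int, x = \sum_i coroot i *~ m i;
  alpha_integral : forall i x, hZ x -> is_integer (alpha i x);
  rho_ : 'I_r -> 'Hom(hT, (R[i])^o);
  rho_integral : forall i x, hZ x -> is_integer (rho_ i x);
  rho_coroot : forall i j, rho_ i (coroot j) = (i == j)%:R
}.

Arguments hT {R r A} D : rename.
Arguments alpha {R r A} D i : rename.
Arguments coroot {R r A} D i : rename.
Arguments hZ {R r A} D : rename.
Arguments rho_ {R r A} D i : rename.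

Section Setup.
Variables (R : realType) (r : nat) (A : 'M[int]_r) (D : root_data R A).
Implicit Types (i j : 'I_r).

Local Notation dual := 'Hom(hT D, (R[i])^o).

Definition charlat_pred : pred dual :=
  fun lam => `[< forall x, hZ D x -> is_integer (lam x) >].

Lemma charlat_zmod_closed : zmod_closed charlat_pred.
Proof.
split=> [|a b].
  by apply/asboolP => x _; exists 0; rewrite lfunE.
rewrite !unfold_in => /asboolP ha /asboolP hb; apply/asboolP => x hx.
have [m em] := ha x hx; have [k ek] := hb x hx.
by exists (m - k); rewrite add_lfunE opp_lfunE em ek rmorphB.
Qed.

HB.instance Definition _ :=
  GRing.isZmodClosed.Build dual charlat_pred charlat_zmod_closed.

Record charlat := Charlat {
  charlat_val : dual;
  charlatP : charlat_pred charlat_val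
}.

HB.instance Definition _ := [isSub for charlat_val].
HB.instance Definition _ := [Choice of charlat by <:].
HB.instance Definition _ := [SubChoice_isSubZmodule of charlat by <:].

Definition alphaX i : charlat := Charlat (asboolT (@alpha_integral _ _ _ D i)).

Definition rho : charlat :=
  \sum_i Charlat (asboolT (@rho_integral _ _ _ D i)).

Definition RT : Type := group_ring charlat.

HB.instance Definition _ := GRing.ComUnitRing.copy RT (group_ring charlat).

Lemma RT_integral (f g : RT) : f * g = 0 -> (f == 0) || (g == 0).
Proof.
have [e [eb he]] := hZ_lattice D.
have eZ k : hZ D (tnth e k).
  apply/he; exists (fun l => (l == k)%:R); rewrite (bigD1 k) //= eqxx.
  rewrite big1 ?addr0 // => l /negbTE ->; exact: mulr0z.
have cP (lam : charlat) k : exists m : int, charlat_val lam (tnth e k) = m%:~R.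
  by case: lam => lam lamP /=; move/asboolP: lamP; apply.
pose c lam k := sval (cid (cP lam k)).
have cE lam k : charlat_val lam (tnth e k) = (c lam k)%:~R by rewrite /c; case: cid.
have cD a b k : c (a + b) k = c a k + c b k.
  have /= h := @intr_inj (R[i]); apply: h.
  by rewrite -cE rmorphD /= -!cE add_lfunE.
have c_inj a b : (forall k, c a k = c b k) -> a = b.
  move=> ab; apply: val_inj; apply/lfunP => x.
  rewrite (coord_basis eb (memvf x)) !linear_sum.
  by apply: eq_bigr => k _; rewrite !linearZ /= -!tnth_nth !cE ab.
exact: (group_ring_integral cD c_inj).
Qed.

HB.instance Definition _ := GRing.ComUnitRing_isIntegral.Build RT RT_integral.

Definition QT : Type := {fraction RT}.

HB.instance Definition _ := GRing.Field.on QT.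

Definition e_ (lam : charlat) : RT := gexp lam.

Definition refl_fun i (lam : dual) : dual := lam - lam (coroot D i) *: alpha D i.

Lemma refl_fun_linear i : linear (refl_fun i).
Proof.
move=> a u v; rewrite /refl_fun add_lfunE scale_lfunE scalerDl opprD addrACA.
by rewrite scalerBr scalerA.
Qed.

HB.instance Definition _ i :=
  GRing.isLinear.Build _ _ _ _ (refl_fun i) (refl_fun_linear i).

Definition refl i : 'End(dual) := linfun (refl_fun i).

Definition word_end (s : seq 'I_r) : 'End(dual) :=
  foldr (fun i g => refl i \o g)%VF \1%VF s.

Lemma word_end_cat s t : word_end (s ++ t) = (word_end s \o word_end t)%VF.
Proof.
by elim: s => [|i s IH] /=; rewrite ?comp_lfun1l // IH comp_lfunA.
Qed.

Lemma refl_invol i : (refl i \o refl i)%VF = \1%VF.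
Proof.
apply/lfunP => lam; rewrite comp_lfunE id_lfunE !lfunE /= /refl_fun.
rewrite add_lfunE opp_lfunE scale_lfunE alpha_coroot.
have [-> _ _] := gcm D.
rewrite -addrA -opprD -scalerDl; set c := lam _.
have -> : c *: (2%:~R : (R[i])^o) = c + c.
  by rewrite -[LHS]/(c * 2%:R) mulr_natr mulr2n.
rewrite addrA subrr.
by rewrite scale0r subr0.
Qed.

Lemma word_end_rev s : (word_end s \o word_end (rev s))%VF = \1%VF.
Proof.
elim: s => [|i s IH]; first by rewrite /= comp_lfun1l.
rewrite rev_cons -cats1 word_end_cat /= comp_lfun1r -comp_lfunA.
by rewrite [(word_end s \o _)%VF]comp_lfunA IH comp_lfun1l refl_invol.
Qed.

(* Simple reflections being involutions, the subgroup that they generate is the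
   set of their products. *)
Record weyl := Weyl {
  weyl_val : 'End(dual);
  weylP : `[< exists s, weyl_val = word_end s >]
}.

HB.instance Definition _ := [isSub for weyl_val].
HB.instance Definition _ := [Choice of weyl by <:].

Lemma weyl_one_subproof : `[< exists s, \1%VF = word_end s >].
Proof. by apply/asboolP; exists [::]. Qed.

Lemma weyl_mul_subproof (u v : weyl) :
  `[< exists s, (weyl_val u \o weyl_val v)%VF = word_end s >].
Proof.
have /asboolP[s ->] := weylP u; have /asboolP[t ->] := weylP v.
by apply/asboolP; exists (s ++ t); rewrite word_end_cat.
Qed.

Lemma word_end_inv s : ((word_end s)^-1)%VF = word_end (rev s).
Proof.
apply: lfun_inv_unique (word_end_rev s) _.
by have := word_end_rev (rev s); rewrite revK.
Qed.

Lemma weyl_inv_subproof (u : weyl) :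
  `[< exists s, ((weyl_val u)^-1)%VF = word_end s >].
Proof.
have /asboolP[s ->] := weylP u.
by apply/asboolP; exists (rev s); rewrite word_end_inv.
Qed.

Definition weyl_one := Weyl weyl_one_subproof.
Definition weyl_mul u v := Weyl (weyl_mul_subproof u v).
Definition weyl_inv u := Weyl (weyl_inv_subproof u).

Lemma weyl_mulA : associative weyl_mul.
Proof. by move=> u v w; apply: val_inj; rewrite /= comp_lfunA. Qed.

Lemma weyl_mul1 : left_id weyl_one weyl_mul.
Proof. by move=> u; apply: val_inj; rewrite /= comp_lfun1l. Qed.

Lemma weyl_mul1r : right_id weyl_one weyl_mul.
Proof. by move=> u; apply: val_inj; rewrite /= comp_lfun1r. Qed.

Lemma weyl_mulV : left_inverse weyl_one weyl_inv weyl_mul.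
Proof.
move=> u; apply: val_inj => /=; have /asboolP[s ->] := weylP u.
by rewrite word_end_inv; have := word_end_rev (rev s); rewrite revK.
Qed.

Lemma weyl_mulrV : right_inverse weyl_one weyl_inv weyl_mul.
Proof.
move=> u; apply: val_inj => /=; have /asboolP[s ->] := weylP u.
by rewrite word_end_inv word_end_rev.
Qed.

HB.instance Definition _ := isGroup.Build weyl
  weyl_mulA weyl_mul1 weyl_mul1r weyl_mulV weyl_mulrV.

Lemma sr_subproof i : `[< exists s, refl i = word_end s >].
Proof. by apply/asboolP; exists [:: i]; rewrite /= comp_lfun1r. Qed.

Definition sr i : weyl := Weyl (sr_subproof i).

Lemma weyl_words (w : weyl) : exists s : seq 'I_r, (\prod_(i <- s) sr i)%g = w.
Proof.
have /asboolP[s es] := weylP w; exists s; apply: val_inj => /=.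
rewrite es {w es}; elim: s => [|i s IH]; first by rewrite big_nil.
by rewrite big_cons /= -IH.
Qed.

Lemma act_subproof (w : weyl) (lam : charlat) :
  charlat_pred (weyl_val w (charlat_val lam)).
Proof.
have /asboolP[s ->] := weylP w; elim: s => [|i s /asboolP IH] /=.
  by rewrite id_lfunE; case: lam.
rewrite comp_lfunE; set mu := word_end s _ in IH *.
apply/asboolP => x hx; rewrite lfunE /= /refl_fun.
rewrite add_lfunE opp_lfunE scale_lfunE.
have [a ->] := IH x hx; have [b ->] := IH _ (hZ_coroot D i).
have [c ->] := alpha_integral i hx.
by exists (a - b * c); rewrite rmorphB rmorphM.
Qed.

Definition act (w : weyl) (lam : charlat) : charlat :=
  Charlat (act_subproof w lam).

Lemma len_subproof (w : weyl) :
  exists n, [exists s : n.-tuple 'I_r, (\prod_(i <- s) sr i)%g == w].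
Proof.
have [s <-] := weyl_words w; exists (size s).
by apply/existsP; exists (in_tuple s).
Qed.

Definition len (w : weyl) : nat := ex_minn (len_subproof w).

Definition bruhat_step (u v : weyl) : Prop :=
  (exists x i, v = (u * (x * sr i * x^-1))%g) /\ (len u < len v)%N.

Definition bruhat_le (u v : weyl) : Prop := clos_refl_trans _ bruhat_step u v.

Definition bruhat_lt (u v : weyl) : Prop := bruhat_le u v /\ u <> v.

(* The Kac-Moody algebra is the quotient of [km_term] by [km_eq], i.e. the
   complex Lie algebra generated by the vector space h and by e_i, f_i subject to
   [km_hh] ... [km_serre_f] ([km_h_linear] makes h -> g linear). *)
Inductive km_term : Type :=
| km_h of hT D
| km_e of 'I_r
| km_f of 'I_r
| km_add of km_term & km_term
| km_scale of R[i] & km_term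
| km_br of km_term & km_term.

Local Notation "x +' y" := (km_add x y) (at level 50).
Local Notation "c *' x" := (km_scale c x) (at level 40).
Local Notation "[' x , y ]" := (km_br x y) (at level 0).
Local Notation zero := (km_h 0).

Inductive km_eq : km_term -> km_term -> Prop :=
| km_refl x : km_eq x x
| km_sym x y : km_eq x y -> km_eq y x
| km_trans x y z : km_eq x y -> km_eq y z -> km_eq x z
| km_add_congr x x' y y' : km_eq x x' -> km_eq y y' -> km_eq (x +' y) (x' +' y')
| km_scale_congr c x x' : km_eq x x' -> km_eq (c *' x) (c *' x')
| km_br_congr x x' y y' : km_eq x x' -> km_eq y y' -> km_eq [' x, y] [' x', y']
| km_addA x y z : km_eq (x +' (y +' z)) ((x +' y) +' z)
| km_addC x y : km_eq (x +' y) (y +' x)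
| km_add0 x : km_eq (zero +' x) x
| km_addN x : km_eq (x +' (-1 *' x)) zero
| km_scaleA c d x : km_eq (c *' (d *' x)) ((c * d) *' x)
| km_scale1 x : km_eq (1 *' x) x
| km_scaleDr c x y : km_eq (c *' (x +' y)) ((c *' x) +' (c *' y))
| km_scaleDl c d x : km_eq ((c + d) *' x) ((c *' x) +' (d *' x))
| km_brDl x y z : km_eq [' x +' y, z] ([' x, z] +' [' y, z])
| km_brDr x y z : km_eq [' x, y +' z] ([' x, y] +' [' x, z])
| km_brZl c x y : km_eq [' c *' x, y] (c *' [' x, y])
| km_brZr c x y : km_eq [' x, c *' y] (c *' [' x, y])
| km_brxx x : km_eq [' x, x] zero
| km_jacobi x y z :
    km_eq (([' x, [' y, z]] +' [' y, [' z, x]]) +' [' z, [' x, y]]) zero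
| km_h_linear c (x y : hT D) : km_eq (km_h (c *: x + y)) ((c *' km_h x) +' km_h y)
| km_hh (x y : hT D) : km_eq [' km_h x, km_h y] zero
| km_he (x : hT D) i : km_eq [' km_h x, km_e i] (alpha D i x *' km_e i)
| km_hf (x : hT D) i : km_eq [' km_h x, km_f i] ((- alpha D i x) *' km_f i)
| km_ef i j : km_eq [' km_e i, km_f j] (if i == j then km_h (coroot D i) else zero)
| km_serre_e i j : i != j ->
    km_eq (iter `|1 - A i j|%N (km_br (km_e i)) (km_e j)) zero
| km_serre_f i j : i != j ->
    km_eq (iter `|1 - A i j|%N (km_br (km_f i)) (km_f j)) zero.

Definition is_root (beta : dual) : Prop :=
  beta <> 0 /\ exists2 x, ~ km_eq x zero &
    forall y : hT D, km_eq [' km_h y, x] (beta y *' x).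

(* Roots are integral combinations of simple roots, hence lie in [charlat]. *)
Definition pos_roots : set charlat :=
  [set beta | is_root (val beta) /\
     exists m : 'I_r -> nat, beta = \sum_i alphaX i *+ m i]%classic.

Definition neg_roots : set charlat := [set - beta | beta in pos_roots]%classic.

Definition Delta (w : weyl) : set charlat :=
  (pos_roots `&` (act w^-1%g @` neg_roots))%classic.

Definition toQ (f : RT) : QT := @tofrac RT f.

Definition demazure i (f : weyl -> QT) : weyl -> QT := fun v =>
  (f v - f (v * sr i)%g * toQ (e_ (- act v (alphaX i))))
    / (1 - toQ (e_ (- act v (alphaX i)))).

(* [Delta w^-1] is finite, so that the product over it is a genuine one. *)
Record is_psi_family (psi : weyl -> weyl -> RT) : Prop := IsPsiFamily {
  psi_support : forall w v, ~ bruhat_le w v -> psi w v = 0;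
  psi_diag : forall w,
    psi w w = \big[*%R/1]_(beta \in Delta w^-1%g) (1 - e_ beta);
  psi_demazure_lt : forall w i, bruhat_lt (w * sr i)%g w ->
    demazure i (fun v => toQ (psi w v)) =
      fun v => toQ (psi w v) + toQ (psi (w * sr i)%g v);
  psi_demazure_gt : forall w i, bruhat_lt w (w * sr i)%g ->
    demazure i (fun v => toQ (psi w v)) = fun _ => 0;
  psi_one : forall v, psi 1%g v = e_ (rho - act v rho)
}.

Definition is_order (w : weyl) (m : nat) : Prop :=
  [/\ (0 < m)%N, (w ^+ m)%g = 1%g
    & forall k, (0 < k)%N -> (w ^+ k)%g = 1%g -> (m <= k)%N].

(* The word i j i j ... with m letters. *)
Definition alternating (m : nat) i j : seq 'I_r :=
  [seq if odd k then j else i | k <- iota 0 m].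

(* The congruence presenting \underline W as a quotient of the free monoid; there
   is no braid relation between i and j when r_i r_j has infinite order. *)
Inductive uword_eq : seq 'I_r -> seq 'I_r -> Prop :=
| uword_refl s : uword_eq s s
| uword_sym s t : uword_eq s t -> uword_eq t s
| uword_trans s t u : uword_eq s t -> uword_eq t u -> uword_eq s u
| uword_cat s s' t t' : uword_eq s s' -> uword_eq t t' ->
    uword_eq (s ++ t) (s' ++ t')
| uword_idem i : uword_eq [:: i; i] [:: i]
| uword_braid i j m : i != j -> is_order (sr i * sr j)%g m ->
    uword_eq (alternating m i j) (alternating m j i).

Definition uword_eqb : rel (seq 'I_r) := fun s t => `[< uword_eq s t >].

Lemma uword_eqb_refl : reflexive uword_eqb.
Proof. by move=> s; apply/asboolP; apply: uword_refl. Qed.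

Lemma uword_eqb_sym : symmetric uword_eqb.
Proof. by move=> s t; apply/asboolP/asboolP => /uword_sym. Qed.

Lemma uword_eqb_trans : transitive uword_eqb.
Proof.
by move=> s t u /asboolP h /asboolP h'; apply/asboolP; apply: uword_trans h h'.
Qed.

Canonical uword_equiv :=
  EquivRel uword_eqb uword_eqb_refl uword_eqb_sym uword_eqb_trans.

Definition uweyl : Type := {eq_quot uword_equiv}.

HB.instance Definition _ := Choice.on uweyl.

Definition uclass (s : seq 'I_r) : uweyl := \pi_({eq_quot uword_equiv}) s.

Lemma uclassP s t : uclass s = uclass t <-> uword_eq s t.
Proof.
split=> [e|e]; last by apply/eqmodP/asboolP.
by apply/asboolP; apply/(@eqmodP _ uword_equiv).
Qed.

Definition uword_of (x : uweyl) : seq 'I_r := repr (x : {eq_quot uword_equiv}).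

Lemma uword_ofK x : uclass (uword_of x) = x.
Proof. exact: reprK. Qed.

Definition uweyl_one : uweyl := uclass [::].
Definition uweyl_mul (x y : uweyl) : uweyl := uclass (uword_of x ++ uword_of y).

Lemma uweyl_mul_class s t : uweyl_mul (uclass s) (uclass t) = uclass (s ++ t).
Proof. by apply/uclassP; apply: uword_cat; apply/uclassP; rewrite uword_ofK. Qed.

Lemma uweyl_mulA : associative uweyl_mul.
Proof.
move=> x y z; rewrite -(uword_ofK x) -(uword_ofK y) -(uword_ofK z).
by rewrite !uweyl_mul_class catA.
Qed.

Lemma uweyl_mul1 : left_id uweyl_one uweyl_mul.
Proof. by move=> x; rewrite -(uword_ofK x) uweyl_mul_class. Qed.

Lemma uweyl_mul1r : right_id uweyl_one uweyl_mul.
Proof. by move=> x; rewrite -(uword_ofK x) uweyl_mul_class cats0. Qed.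

HB.instance Definition _ :=
  isMonoid.Build uweyl uweyl_mulA uweyl_mul1 uweyl_mul1r.

Definition ur i : uweyl := uclass [:: i].

Lemma reduced_word_subproof (w : weyl) :
  exists s : (len w).-tuple 'I_r, (\prod_(i <- s) sr i)%g == w.
Proof. by apply/existsP; rewrite /len; case: ex_minnP. Qed.

(* The element of \underline W attached to w; by Matsumoto's theorem it does not
   depend on the reduced decomposition that is picked. *)
Definition underline (w : weyl) : uweyl :=
  (\prod_(i <- xchoose (reduced_word_subproof w)) ur i)%g.

End Setup.

(* Main.v *)
(* Evaluating (iii) at v gives a recursion for psi^w(v r_i) in terms of psi^w(v)
   and psi^{w r_i}(v), the same as that of the right-hand side when a letter is
   appended to the word for v.  The right-hand side obeys it once \underline W is
   identified with W in such a way that right multiplication by \underline r_i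
   is w |-> max(w, w r_i).  That identification rests on the exchange condition
   in W, which is read off psi instead of the root system: if u < v = u r_i, then
   psi^u(v) is a unit times psi^u(u) <> 0, whereas by the recursion psi^u(v) = 0
   unless u is the Demazure product of a subword of the given word for v.  The
   parity of the length comes from the determinant of W on h^*. *)
Require Import Defs.
From HB Require Import structures.
From mathcomp Require Import all_boot all_algebra.
From mathcomp Require Import fraction boolp fsbigop reals complex.
From mathcomp Require Import monalg ring.
From Stdlib Require Import Relation_Operators.

Set Implicit Arguments.
Unset Strict Implicit.
Unset Printing Implicit Defensive.

Import GRing.Theory Num.Theory passmx.
Local Open Scope ring_scope.
Local Open Scope complex_scope.

(** * Determinants of reflections and parity of the length *)

(** [e1] and [e2] are two triangular factorizations of the same block matrix, whose determinants are
    compared. *)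
Lemma det_rank_one_update (K : comNzRingType) n (u : 'cV[K]_n) (v : 'rV[K]_n) :
  \det (1%:M - u *m v) = 1 - (v *m u) 0 0.
Proof.
have e1 : block_mx 1%:M 0 v 1%:M *m block_mx 1%:M u 0 (1%:M - v *m u)
    = block_mx 1%:M u v 1%:M.
  by rewrite mulmx_block !mul1mx !mul0mx ?mulmx1 ?mulmx0 ?mul0mx ?addr0 ?(addrC (v *m u)) ?subrK.
have e2 : block_mx 1%:M u 0 1%:M *m block_mx (1%:M - u *m v) 0 v 1%:M
    = block_mx 1%:M u v 1%:M.
  by rewrite mulmx_block !mul1mx !mul0mx ?mulmx1 ?mulmx0 ?mul0mx ?add0r ?addr0 ?subrK.
have := congr1 determinant (etrans e1 (esym e2)).
rewrite !det_mulmx !det_lblock !det_ublock !det1 !mul1r mulr1 => <-.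
by rewrite det_mx11 !mxE eqxx.
Qed.

Section Length.
Variables (R : realType) (r : nat) (A : 'M[int]_r) (D : root_data R A).
Implicit Types (w v x y : weyl D) (s t : seq 'I_r).

Local Notation dual := 'Hom(hT D, (R[i])^o).
Local Notation wp s := (\prod_(i <- s) sr D i)%g.

Definition weyl_det w : R[i] :=
  \det (mxof (vbasis {:dual}) (vbasis {:dual}) (weyl_val w)).

Lemma weyl_det_mul x y : weyl_det (x * y)%g = weyl_det x * weyl_det y.
Proof.
by rewrite /weyl_det (mxof_comp _ _ (vbasisP _)) det_mulmx mulrC.
Qed.

(** In coordinates the reflection is the identity minus a rank-one matrix, with [u] the evaluation
    at the coroot and [v] the simple root; the determinant is therefore 1 - 2. *)
Lemma weyl_det_sr i : weyl_det (sr D i) = -1.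
Proof.
rewrite /weyl_det; set e := vbasis _; have eb : basis_of {:dual} e := vbasisP _.
pose u : 'cV[R[i]]_(\dim {:dual}) := \col_k (e`_k : dual) (coroot D i).
pose v := rVof e (alpha D i).
have -> : mxof e e (weyl_val (sr D i)) = 1%:M - u *m v.
  apply/row_matrixP => k; rewrite [LHS]rowE mul_mxof vecof_delta lfunE /= /refl_fun.
  rewrite linearB linearZ /= rVofE //.
  by apply/rowP => j; rewrite !mxE big_ord1 !mxE eqxx [k == j]eq_sym.
rewrite det_rank_one_update.
have -> : (v *m u) 0 0 = alpha D i (coroot D i).
  rewrite [alpha D i in RHS](coord_basis eb (memvf _)) sum_lfunE !mxE.
  by apply: eq_bigr => k _; rewrite !mxE scale_lfunE.
have [d2 _ _] := gcm D.
rewrite alpha_coroot d2 -[2%:~R]/(2%:R : R[i]) mulr2n opprD addrA subrr.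
by rewrite add0r.
Qed.

Lemma lenP w : exists2 s, size s = len w & wp s = w.
Proof.
rewrite /len; case: ex_minnP => n /existsP[s /eqP <-] _.
by exists s; rewrite ?size_tuple.
Qed.

Lemma len_word s : (len (wp s) <= size s)%N.
Proof.
rewrite /len; case: ex_minnP => n _; apply; apply/existsP.
by exists (in_tuple s).
Qed.

Lemma sr_invol i : (sr D i * sr D i = 1)%g.
Proof. by apply: val_inj; apply: refl_invol. Qed.

Lemma weyl_det_len w : weyl_det w = (-1) ^+ len w.
Proof.
have [s <- <-] := lenP w; elim: s => [|i s IH] /=; last first.
  by rewrite big_cons weyl_det_mul weyl_det_sr IH exprS.
by rewrite big_nil /weyl_det mxof1 ?det1 // (basis_free (vbasisP _)).
Qed.

Lemma odd_len_mulsr w i : odd (len (w * sr D i)%g) = ~~ odd (len w).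
Proof.
have := weyl_det_mul w (sr D i); rewrite weyl_det_sr !weyl_det_len -exprSr.
by rewrite -[LHS]signr_odd -[RHS]signr_odd => /signr_inj.
Qed.

End Length.

Lemma subseq_catE (T : eqType) (u s t : seq T) : subseq u (s ++ t) ->
  exists u1 u2, [/\ u = u1 ++ u2, subseq u1 s & subseq u2 t].
Proof.
case/subseqP => m; rewrite size_cat => sm ->.
exists (mask (take (size s) m) s), (mask (drop (size s) m) t).
rewrite !mask_subseq; split=> //.
by rewrite -mask_cat ?cat_take_drop // size_takel // sm leq_addr.
Qed.

(** * Length and Demazure products in a group generated by involutions *)

Section LengthFunction.
Variables (G : groupType) (I : eqType) (g : I -> G) (len : G -> nat).
Implicit Types (w x y z : G) (s t u : seq I) (i j : I).
Local Open Scope group_scope.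
Local Notation wp s := (\prod_(i <- s) g i).

Hypothesis gg : forall i, g i * g i = 1.
Hypothesis lenP : forall w, exists2 s, size s = len w & wp s = w.
Hypothesis len_word : forall s, (len (wp s) <= size s)%N.
Hypothesis odd_len : forall w i, odd (len (w * g i)) = ~~ odd (len w).

Lemma len_mul x y : (len (x * y) <= len x + len y)%N.
Proof.
have [s <- <-] := lenP x; have [t <- <-] := lenP y.
by rewrite -big_cat -size_cat; apply: len_word.
Qed.

Lemma len1 : len 1 = 0%N.
Proof. by apply/eqP; rewrite -leqn0; have := len_word [::]; rewrite big_nil. Qed.

Lemma len_eq0 w : len w = 0%N -> w = 1.
Proof. by move=> e; have [s] := lenP w; rewrite e => /size0nil -> <-; rewrite big_nil. Qed.

Lemma mulgenK w i : w * g i * g i = w.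
Proof. by rewrite -mulgA gg mulg1. Qed.

Lemma mulKgen w i : g i * (g i * w) = w.
Proof. by rewrite mulgA gg mul1g. Qed.

Lemma geninv i : (g i)^-1 = g i.
Proof. by apply: (@mulgI _ (g i)); rewrite mulgV gg. Qed.

Lemma len_gen i : len (g i) = 1%N.
Proof.
have := len_word [:: i]; rewrite big_seq1 /=.
by have := odd_len 1 i; rewrite mul1g len1; case: (len _) => [|[|]].
Qed.

(** The triangle inequality at [w] and at [w * g i] bounds the difference by one, and parity
    excludes equality. *)
Lemma len_mulgen w i : len (w * g i) = (len w).+1 \/ len w = (len (w * g i)).+1.
Proof.
have := len_mul w (g i); have := len_mul (w * g i) (g i).
have := odd_len w i; rewrite mulgenK len_gen !addn1.
case: (ltngtP (len w) (len (w * g i))) => [lt _ _ le|lt _ le _|-> /=].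
- by left; apply/eqP; rewrite eqn_leq le lt.
- by right; apply/eqP; rewrite eqn_leq le lt.
- by case: odd.
Qed.

Lemma prod_rev s : wp (rev s) = (wp s)^-1.
Proof.
elim: s => [|i s IH]; first by rewrite !big_nil invg1.
by rewrite rev_cons big_rcons big_cons IH invgM geninv.
Qed.

Lemma len_inv w : len w^-1 = len w.
Proof.
suff le v : (len v^-1 <= len v)%N by apply/eqP; rewrite eqn_leq le -{1}[w]invgK le.
by have [s <- <-] := lenP v; rewrite -prod_rev -(size_rev s).
Qed.

Lemma len_genmul w i : len (g i * w) = (len w).+1 \/ len w = (len (g i * w)).+1.
Proof.
have := len_mulgen w^-1 i.
by rewrite -[w^-1 * g i]invgK invgM invgK geninv !len_inv.
Qed.

(** This is right multiplication by the idempotent generator of index [i], transported to [G]. *)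
Definition star w i := if (len w < len (w * g i))%N then w * g i else w.

(* The Demazure product of the letters of [s] *)
Definition dem s := foldl star 1 s.

Lemma dem_rcons s i : dem (rcons s i) = star (dem s) i.
Proof. by rewrite /dem foldl_rcons. Qed.

Lemma len_star w i : (len (star w i) <= (len w).+1)%N.
Proof. by rewrite /star; case: ifP => // _; have := len_mul w (g i); rewrite len_gen addn1. Qed.

Lemma len_dem s : (len (dem s) <= size s)%N.
Proof.
elim/last_ind: s => [|s i IH]; first by rewrite /dem /= len1.
by rewrite dem_rcons size_rcons (leq_trans (len_star _ _)).
Qed.

Lemma star_up w i : (len w < len (w * g i))%N -> star w i = w * g i.
Proof. by rewrite /star => ->. Qed.

Lemma star_down w i : (len (w * g i) < len w)%N -> star w i = w.
Proof. by rewrite /star => /ltnW; rewrite leqNgt => /negbTE ->. Qed.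

(** Each letter raises the length by at most one, so under the hypothesis no letter is absorbed and
    every [star] is a multiplication. *)
Lemma dem_prod s : size s = len (dem s) -> dem s = wp s.
Proof.
elim/last_ind: s => [|s i IH]; first by rewrite big_nil.
rewrite dem_rcons size_rcons big_rcons /star => e.
have ls : size s = len (dem s).
  apply/eqP; rewrite eqn_leq len_dem andbT -ltnS e.
  exact: len_star.
rewrite -(IH ls); case: ifP => // h.
by move: e; rewrite /star h ls => /eqP; rewrite (gtn_eqF (ltnSn _)).
Qed.

Definition reduced s := size s = len (wp s).

Lemma reduced_cat s t : reduced (s ++ t) -> reduced s /\ reduced t.
Proof.
rewrite /reduced size_cat big_cat => e.
have ls := len_word s; have lt := len_word t.
have le := len_mul (wp s) (wp t); rewrite -e in le.
have [e1|n1] := eqVneq (size s) (len (wp s)).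
  split=> //; apply/eqP; rewrite eqn_leq lt andbT.
  by move: le; rewrite e1 leq_add2l.
exfalso; move: le; apply/negP; rewrite -ltnNge.
have ls' : (len (wp s) < size s)%N by rewrite ltn_neqAle eq_sym n1.
by rewrite (@leq_ltn_trans (len (wp s) + size t)) ?leq_add2l ?ltn_add2r.
Qed.

Lemma reduced_dem s : reduced s -> dem s = wp s.
Proof.
elim/last_ind: s => [|s i IH]; first by rewrite big_nil.
rewrite -cats1 => rs; have [/IH ds _] := reduced_cat rs; move: rs.
rewrite cats1 dem_rcons ds /reduced size_rcons big_rcons => e.
by rewrite star_up // -e ltnS.
Qed.

Lemma ltn_mulgen w i : (len w < len (w * g i))%N = ~~ (len (w * g i) < len w)%N.
Proof. by case: (len_mulgen w i) => ->; rewrite ltnSn ltnNge leqnSn. Qed.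

Lemma starK w i : star (star w i) i = star w i.
Proof.
rewrite {2 3}/star; case: ifP => h; first by rewrite star_down // mulgenK.
by rewrite /star h.
Qed.

(** With [star_eq_down], this gives the fibres of [star]: empty over [w] at an ascent, the pair [w],
    [w * g i] at a descent. *)
Lemma star_eq_up x w i : (len w < len (w * g i))%N -> (star x i == w) = false.
Proof.
move=> h; apply/eqP => e; move: h; rewrite -e /star.
case: ifP => [lx|->] //.
by rewrite mulgenK ltnNge ltnW.
Qed.

Lemma star_eq_down x w i : (len (w * g i) < len w)%N ->
  (star x i == w) = (x == w) || (x == w * g i).
Proof.
move=> h; apply/eqP/orP => [<-|[/eqP->|/eqP->]].
- rewrite /star; case: ifP => _; last by left.
  by right; rewrite mulgenK.
- by rewrite star_down.
- by rewrite star_up mulgenK.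
Qed.

(* The alternating word of [k] letters that ends with [i], whereas [alternating]
   fixes the first letter. *)
Fixpoint altr k i j := if k is k'.+1 then rcons (altr k' j i) i else [::].

Lemma size_altr k i j : size (altr k i j) = k.
Proof. by elim: k i j => //= k IH i j; rewrite size_rcons IH. Qed.

Lemma altrSl k i j : altr k.+1 i j = (if odd k then j else i) :: altr k i j.
Proof.
elim: k i j => // k IH i j.
by rewrite -[LHS]/(rcons (altr k.+1 j i) i) IH /= if_neg.
Qed.

Lemma alternatingE k i j :
  [seq if odd n then j else i | n <- iota 0 k]
    = if odd k then altr k i j else altr k j i.
Proof.
elim: k => // k IH; rewrite -[k.+1]addn1 iotaD map_cat IH /= add0n cats1 addn1 /=.
by case: odd.
Qed.

(** * Alternating words, the exchange condition and descents *)

Local Notation alt k i j := (wp (altr k i j)).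

Lemma altS k i j : alt k.+1 i j = alt k j i * g i.
Proof. by rewrite /= big_rcons. Qed.

Lemma len_alt k i j : (len (alt k i j) <= k)%N.
Proof. by have := len_word (altr k i j); rewrite size_altr. Qed.

Lemma altr_swap k i j : alt k j i = alt k i j * (g i * g j) ^+ k.
Proof.
elim: k i j => [|k IH] i j; first by rewrite /= big_nil mulg1.
rewrite !altS (IH j i) -!mulgA; congr (_ * _).
have -> n : (g i * g j) ^+ n = g i * (g j * g i) ^+ n * g i.
  elim: n => [|n IHn]; first by rewrite mulg1 gg.
  by rewrite !expgS IHn -!mulgA.
by rewrite !mulgA gg mul1g expgSr -!mulgA gg mulg1 .
Qed.

(** Translates between braid equalities, which the exchange arguments produce, and the order of
    [g i * g j], which indexes the braid relations. *)
Lemma alt_eq k i j : (alt k i j = alt k j i) <-> ((g i * g j) ^+ k = 1).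
Proof.
rewrite (altr_swap k i j); split=> [e|->]; last by rewrite mulg1.
by apply: (@mulgI _ (alt k i j)); rewrite -e mulg1.
Qed.

Hypothesis subword : forall s w i, wp s = w * g i -> (len w < len (w * g i))%N ->
  exists2 s', subseq s' s & dem s' = w.

(** By [subword], [x * y * g i] is the Demazure product of a subword of a reduced word for [x * y].
    Comparing lengths, exactly one letter is dropped; the two alternatives say whether it lies in
    the word of [x] or of [y]. *)
Lemma exchange x y i :
  len (x * y) = (len x + len y)%N -> (len (x * y * g i) < len (x * y))%N ->
  (exists2 x', (len x' < len x)%N & x * y * g i = x' * y) \/
  (len (y * g i) < len y)%N.
Proof.
move=> lxy lt; have [s ss es] := lenP x; have [t st et] := lenP y.
have [u ue] : exists u : G, x * y * g i = u by exists (x * y * g i).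
rewrite ue in lt *.
have vE : wp (s ++ t) = x * y by rewrite big_cat /= es et.
have uK : wp (s ++ t) = u * g i by rewrite vE -ue mulgenK.
have [|s' ss' es'] := @subword _ _ _ uK; first by rewrite -uK vE.
have [s1 [s2 [e1 sub1 sub2]]] := subseq_catE ss'.
have lu : len (x * y) = (len u).+1.
  have := len_mulgen (x * y) i; rewrite ue => -[h|//].
  by rewrite h ltnNge leqnSn in lt.
have rst : reduced (s ++ t) by rewrite /reduced vE lxy size_cat ss st.
(* A subword of full size would be the whole reduced word, whose Demazure product is [x * y] and not
   [u]. *)
have lts : (size s' < size (s ++ t))%N.
  have [le eqs] := size_subseq_leqif ss'.
  rewrite ltn_neqAle le andbT eqs; apply/negP => /eqP e.
  by move: lt; rewrite -es' e reduced_dem // vE ltnn.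
have szs' : size s' = len u.
  apply/eqP; rewrite eqn_leq -ltnS -lu -[X in _ && (len X <= _)%N]es' len_dem // andbT.
  by rewrite lxy -ss -st -size_cat.
have uE : u = wp s1 * wp s2.
  by rewrite -es' dem_prod ?es' // e1 big_cat.
have [l1 q1] := size_subseq_leqif sub1; have [l2 q2] := size_subseq_leqif sub2.
have sz : (size s1 + size s2).+1 = (size s + size t)%N.
  by rewrite -size_cat -e1 szs' -lu lxy ss st.
have [e|n1] := eqVneq (size s1) (size s).
  right; move/eqP: e; rewrite q1 => /eqP e; rewrite e in sz uE.
  have -> : y * g i = wp s2.
    by apply: (@mulgI _ x); rewrite mulgA ue uE es.
  apply: leq_ltn_trans (len_word s2) _; rewrite -st.
  by move/eqP: sz; rewrite -addnS eqn_add2l => /eqP <-.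
left; have lt1 : (size s1 < size s)%N by rewrite ltn_neqAle n1.
have e2 : size s2 = size t.
  apply/eqP; rewrite eqn_leq l2 /=.
  by rewrite -(leq_add2l (size s)) -sz -addSn leq_add2r.
exists (wp s1); first by rewrite -ss; apply: leq_ltn_trans (len_word s1) lt1.
by move/eqP: e2; rewrite q2 => /eqP e2; rewrite uE e2 et.
Qed.

(** Split off the first letter [g c] and apply [exchange]. If [g c] is the letter dropped, the other
    alternating word appears. Otherwise, by induction, the tail equals an alternating word that also
    starts with [c]; the two letters cancel, against the length. *)
Lemma alt_descent k i j :
  len (alt k i j) = k -> (len (alt k i j * g j) < k)%N -> alt k i j = alt k j i.
Proof.
elim: k i j => // k IH i j; rewrite altrSl big_cons.
set c := if _ then _ else _; set y := alt k i j => lk lt.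
have ly : len y = k.
  apply/eqP; rewrite eqn_leq len_alt -ltnS -lk.
  by rewrite (leq_trans (len_mul _ _)) // len_gen add1n.
have [||[x' lx' e]|lty] := @exchange (g c) y j.
- by rewrite lk len_gen ly.
- by rewrite lk.
- rewrite (altS k j i) -/y; move: e; rewrite (@len_eq0 x') ?mul1g => [e|].
    by rewrite -[g c * y](mulgenK _ j) e.
  by move: lx'; rewrite len_gen; case: (len x').
have k0 : (0 < k)%N by rewrite -ly; apply: leq_ltn_trans lty.
have e : y = alt k j i by apply: IH; rewrite // -[X in (_ < X)%N]ly.
move: lk; rewrite e /c; case: (k) k0 => // m _.
rewrite altrSl big_cons /= if_neg mulKgen => lk.
by have := len_alt m j i; rewrite lk ltnNge leqnSn.
Qed.

(* Two right descents i, j of w split off alternating factors of growing length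
   until the order of g i * g j is reached. *)
Lemma two_descents w i j k :
  (len (w * g i) < len w)%N -> (len (w * g j) < len w)%N ->
  (forall m, (0 < m < k)%N -> alt m i j <> alt m j i) ->
  exists2 x, w = x * alt k i j & len w = (len x + k)%N.
Proof.
elim: k i j => [|k IH] i j di dj hk; first by exists w; rewrite ?big_nil ?mulg1 ?addn0.
have [||m /andP[m0 mk] e|x wx lw] := IH j i => //.
  by apply: (hk m _ (esym e)); rewrite m0 ltnW.
have ly : len (alt k j i) = k.
  apply/eqP; rewrite eqn_leq len_alt.
  by rewrite -(leq_add2l (len x)) -lw wx len_mul.
have [||[x' lx' e]|lty] := @exchange x (alt k j i) i.
- by rewrite -wx lw ly.
- by rewrite -wx.
- have ew : w = x' * alt k.+1 i j by rewrite altS mulgA -e -wx mulgenK.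
  exists x' => //; apply/eqP; rewrite eqn_leq {1}ew.
  rewrite (leq_trans (len_mul _ _)) ?leq_add2l ?len_alt //=.
  by rewrite lw addnS -addSn leq_add2r.
(* If the dropped letter lay in the alternating factor, [alt_descent] would give a braid equality of
   length excluded by [hk]. *)
case: k => [|k] in hk ly lty IH wx lw *; first by rewrite ly in lty.
exfalso; apply: (hk k.+1); first by rewrite /= ltnSn.
by apply/esym/alt_descent; rewrite // -[X in (_ < X)%N]ly.
Qed.

(** The abstract form of [is_order], convertible to it for [weyl D]. *)
Definition is_ord z m := [/\ (0 < m)%N, z ^+ m = 1 &
  forall k, (0 < k)%N -> z ^+ k = 1 -> (m <= k)%N].

Lemma alt_order i j k : (0 < k)%N -> alt k i j = alt k j i ->
  exists2 m, is_ord (g i * g j) m & forall n, (0 < n < m)%N -> alt n i j <> alt n j i.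
Proof.
move=> k0 ek.
have ex : exists n, (0 < n)%N && (alt n i j == alt n j i) by exists k; rewrite k0 ek eqxx.
case: (ex_minnP ex) => m /andP[m0 /eqP em] mmin; exists m.
  split=> // [|n n0 en]; first exact/alt_eq.
  by apply: mmin; rewrite n0; apply/eqP/alt_eq.
move=> n /andP[n0 nm] en; move: nm; rewrite ltnNge => /negP; apply.
by apply: mmin; rewrite n0 en eqxx.
Qed.

(** By [alt_descent], a first failure to grow would equate the two alternating words of some
    positive length below [m], against the minimality of [m]. *)
Lemma alt_reduced i j m k : is_ord (g i * g j) m -> (k <= m)%N ->
  len (alt k i j) = k /\ len (alt k j i) = k.
Proof.
case=> _ _ mmin; elim: k => [|k IH] km; first by rewrite /= big_nil len1.
have [l1 l2] := IH (ltnW km).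
suff ne : k = 0%N \/ alt k i j <> alt k j i.
  have h a b : len (alt k a b) = k -> (k = 0%N \/ alt k a b <> alt k b a) ->
      len (alt k.+1 b a) = k.+1.
    move=> la na; rewrite altS; case: (len_mulgen (alt k a b) b) => [->|]; first by rewrite la.
    rewrite la => e; case: na => [k0|[]]; first by rewrite k0 in e.
    by apply: alt_descent; rewrite // {2}e.
  split; apply: h => //.
  by case: ne => [|ne]; [left|right => /esym].
case: k km {IH l1 l2} => [|k] km; [by left|right].
by move/alt_eq => e; have := mmin k.+1 isT e; rewrite leqNgt km.
Qed.

(** * Matsumoto's theorem and reduction of words modulo idempotents *)

Section Congruence.
Variable E : seq I -> seq I -> Prop.
Hypothesis E_refl : forall s, E s s.
Hypothesis E_trans : forall s t u, E s t -> E t u -> E s u.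
Hypothesis E_cat : forall s s' t t', E s s' -> E t t' -> E (s ++ t) (s' ++ t').
Hypothesis E_braid : forall i j m, i != j -> is_ord (g i * g j) m ->
  E (altr m i j) (altr m j i).

Lemma reduced_rcons s i : reduced (rcons s i) ->
  reduced s /\ (len (wp (rcons s i) * g i) < len (wp (rcons s i)))%N.
Proof.
move=> rs; have [|r1 _] := @reduced_cat s [:: i]; first by rewrite cats1.
by split=> //; rewrite -[X in (_ < X)%N]rs big_rcons mulgenK size_rcons -r1.
Qed.

(* Matsumoto's theorem *)
Lemma reduced_words_congruent s t : reduced s -> reduced t -> wp s = wp t -> E s t.
Proof.
have [n] := ubnP (size s); elim: n s t => // n IH s t.
case/lastP: s => [|s i] sn rs rt e.
  by move: rt; rewrite /reduced -e -rs /= => /size0nil ->.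
case/lastP: t rt e => [|t j] rt e.
  by move: rs; rewrite /reduced e -rt size_rcons.
rewrite size_rcons ltnS in sn.
have [rs' di] := reduced_rcons rs; have [rt' dj] := reduced_rcons rt.
have IHr u v a : reduced (rcons u a) -> reduced (rcons v a) ->
    wp (rcons u a) = wp (rcons v a) -> (size u < n)%N -> E (rcons u a) (rcons v a).
  move=> ru rv euv lu; rewrite -!cats1; apply: E_cat => //.
  apply: IH; rewrite //; [by case: (reduced_rcons ru)|by case: (reduced_rcons rv)|].
  by move: euv; rewrite !big_rcons => /mulIg.
have [eij|nij] := eqVneq i j; first by rewrite -eij in rt e *; apply: IHr.
rewrite -e in dj; set w := wp _ in di dj.
(* If no two alternating words coincided, [two_descents] would split off from [w] an alternating
   factor longer than [w]. *)
have [k k0 ek] : exists2 k, (0 < k)%N & alt k i j = alt k j i.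
  apply: contrapT => nk.
  have [|x _] := @two_descents w i j (len w).+1 di dj.
    by move=> m /andP[m0 _] em; apply: nk; exists m.
  by move=> h; have := leq_addl (len x) (len w).+1; rewrite -h ltnn.
have [m om mmin] := alt_order k0 ek.
have [x wx lx] := two_descents di dj mmin.
have wx' : w = x * alt m j i.
  by case: om => _ /alt_eq <-.
have m0 : (0 < m)%N by case: om.
have [u su eu] := lenP x.
have [m' em] : exists m', m = m'.+1 by case: (m) m0 => // m'; exists m'.
have size_w : size (rcons s i) = len w by [].
have size_u a b : size (u ++ altr m a b) = len w by rewrite size_cat size_altr su -lx.
have cu a b : u ++ altr m a b = rcons (u ++ altr m' b a) a by rewrite em /= rcons_cat.
have wu1 : wp (u ++ altr m i j) = w by rewrite big_cat /= eu -wx.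
have wu2 : wp (u ++ altr m j i) = w by rewrite big_cat /= eu -wx'.
(* [s] and [t] are joined through two reduced words of [w] that differ by a braid relation and end
   in [i] and [j]; the outer links share a last letter and follow from [IHr]. *)
apply: (@E_trans _ (u ++ altr m i j)).
  by rewrite cu; apply: IHr; rewrite -?cu ?/reduced ?wu1.
apply: (@E_trans _ (u ++ altr m j i)).
  by apply: E_cat => //; apply: E_braid.
rewrite cu; apply: IHr; rewrite -?cu ?/reduced ?wu2 //.
by rewrite -(ltn_add2r 1) !addn1 -(size_rcons _ j) -cu size_u -size_w size_rcons.
Qed.

Hypothesis E_idem : forall i, E [:: i; i] [:: i].

Lemma reduced_word w : exists2 s, reduced s & wp s = w.
Proof. by have [s ss sw] := lenP w; exists s; rewrite // /reduced ss sw. Qed.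

(** Induction on the last letter. At a descent, [dem s] has a reduced word ending in [i], and the
    idempotent relation absorbs the repeated letter. *)
Lemma congruent_dem s t : reduced t -> wp t = dem s -> E s t.
Proof.
elim/last_ind: s t => [|s i IH] t rt.
  by rewrite /dem /= => e; move: rt; rewrite /reduced e len1 => /size0nil ->.
rewrite dem_rcons /star; case: ifP => h e.
  have [u ru eu] := reduced_word (dem s).
  have rui : reduced (rcons u i).
    rewrite /reduced size_rcons big_rcons /= ru eu.
    by case: (len_mulgen (dem s) i) => // l; rewrite l ltnNge leqnSn in h.
  apply: (@E_trans _ (rcons u i)).
    by rewrite -!cats1; apply: E_cat => //; apply: IH.
  by apply: reduced_words_congruent => //; rewrite big_rcons /= eu -e.
have [u ru eu] := reduced_word (dem s * g i).
have rui : reduced (rcons u i).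
  rewrite /reduced size_rcons big_rcons /= ru eu mulgenK.
  by case: (len_mulgen (dem s) i) => // l; rewrite l ltnSn in h.
have eui : wp (rcons u i) = dem s by rewrite big_rcons /= eu mulgenK.
apply: (@E_trans _ (rcons (rcons u i) i)).
  by rewrite -[rcons s i]cats1 -[rcons (rcons u i) i]cats1; apply: E_cat => //; apply: IH.
apply: (@E_trans _ (rcons u i)).
  by rewrite -!cats1 -catA; apply: E_cat => //; apply: E_idem.
by apply: reduced_words_congruent => //; rewrite eui e.
Qed.

End Congruence.

(** * Braid invariance of the Demazure action *)

Definition lstar i w := if (len w < len (g i * w))%N then g i * w else w.

(** Lets the braid relations be checked at the neutral element only. The four cases are the ascents
    and descents of [w] on either side. *)
Lemma lstar_star i j w : star (lstar i w) j = lstar i (star w j).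
Proof.
rewrite {1}/lstar {2}/star.
have u1 : len w = (len (w * g j)).+1 -> ~~ (len w < len (w * g j))%N.
  by move=> ->; rewrite -leqNgt leqnSn.
have u2 : len w = (len (g i * w)).+1 -> ~~ (len w < len (g i * w))%N.
  by move=> ->; rewrite -leqNgt leqnSn.
have le1 x : (len (g i * x) <= (len x).+1)%N by case: (len_genmul x i) => ->; rewrite // ltnW.
have le2 x : (len (x * g j) <= (len x).+1)%N by case: (len_mulgen x j) => ->; rewrite // ltnW.
case: (len_genmul w i) => ei; case: (len_mulgen w j) => ej.
- rewrite ei ej !ltnSn.
  case: (len_mulgen (g i * w) j) => eij.
    rewrite star_up; last by rewrite eij.
    by rewrite /lstar mulgA eij ej ei ltnSn.
  (* The delicate case: both one-sided products are longer than [w], but the two-sided one is not.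
     Exchange forces [g i * w = w * g j]. *)
  have [||[x' lx' e]|] := @exchange (g i) w j.
  + by rewrite ei len_gen.
  + by rewrite [X in (_ < X)%N]eij.
  + have x1 : x' = 1 by apply: len_eq0; move: lx'; rewrite len_gen; case: (len x').
    move: e; rewrite x1 mul1g => e.
    rewrite star_down; last by rewrite e ei.
    rewrite /lstar mulgA e ej ltnNge leqnSn /=.
    by rewrite -[LHS](mulgenK _ j) e.
  + by rewrite ej ltnNge leqnSn.
- rewrite ei ltnSn (negbTE (u1 ej)) /lstar ei ltnSn star_down //.
  by rewrite -mulgA ei ltnS ej.
- rewrite (negbTE (u2 ei)) ej ltnSn star_up ?ej // /lstar mulgA.
  by rewrite ltnNge ej (leq_trans (le2 _)) // -ei leqnSn.
- rewrite (negbTE (u2 ei)) (negbTE (u1 ej)) star_down ?[X in (_ < X)%N]ej //.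
  by rewrite /lstar (negbTE (u2 ei)).
Qed.

(** Write [w] as iterated [lstar] of 1 along a reduced word and commute. At 1 both alternating words
    are reduced, with equal products. *)
Lemma foldl_star_braid i j m w : is_ord (g i * g j) m ->
  foldl star w (altr m i j) = foldl star w (altr m j i).
Proof.
move=> om; have [s rs <-] := reduced_word w.
have lst k x t : foldl star (lstar k x) t = lstar k (foldl star x t).
  by elim: t x => //= a t IH x; rewrite lstar_star IH.
elim: s rs => [|k s IH] rs.
  have [l1 l2] := alt_reduced om (leqnn m).
  rewrite big_nil -!/(dem _) !reduced_dem /reduced ?size_altr //.
  by apply/alt_eq; case: om.
have [_ rs'] := @reduced_cat [:: k] s rs.
have -> : wp (k :: s) = lstar k (wp s).
  by rewrite /lstar -rs' big_cons; move: rs; rewrite /reduced big_cons => <- /=; rewrite ltnSn.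
by rewrite !lst IH.
Qed.

End LengthFunction.

(** * Characters and the recursion for [psi] *)

(** Here [a] and [b] stand for the exponentials of [v alpha_i] and its opposite, [x] and [y] for the
    values of f at [v] and [v r_i], and [c] for that of [D_i f] at [v]. *)
Lemma demazure_eq_solve (K : comPzRingType) (a b x y c : K) :
  a * b = 1 -> x - y * b = c * (1 - b) -> y = a * (x - c) + c.
Proof.
move=> ab e; have {}e : y * b = x - c * (1 - b) by rewrite -e; ring.
have -> : y = a * (y * b) by rewrite mulrCA ab mulr1.
have -> : a * (x - c) + c = a * (x - c) + a * b * c by rewrite ab mul1r.
by rewrite e; ring.
Qed.

Lemma gexp_inj (G : zmodType) : injective (@gexp G).
Proof.
move=> a b e; have : (gexp a : {malg int[G]})@_a = (gexp b : {malg int[G]})@_a by rewrite e.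
by rewrite mcoeffUU mcoeffU; case: eqP => [->|].
Qed.

Section Characters.
Variables (R : realType) (r : nat) (A : 'M[int]_r) (D : root_data R A).
Implicit Types (w v : weyl D) (lam mu : charlat D) (i : 'I_r).

Lemma act_mul w v lam : act (w * v)%g lam = act w (act v lam).
Proof. by apply: val_inj; rewrite /= comp_lfunE. Qed.

Lemma act1 lam : act 1%g lam = lam.
Proof. by apply: val_inj; rewrite /= id_lfunE. Qed.

Lemma act_is_zmod_morphism w : zmod_morphism (act w).
Proof. by move=> lam mu; apply: val_inj; rewrite /= linearB. Qed.

HB.instance Definition _ w :=
  GRing.isZmodMorphism.Build (charlat D) (charlat D) (act w) (act_is_zmod_morphism w).

Lemma act_sr_rho i : act (sr D i) (rho D) = rho D - alphaX D i.
Proof.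
apply: val_inj; rewrite /= lfunE /= /refl_fun; congr (_ - _).
have -> : charlat_val (rho D) = \sum_j rho_ D j.
  by rewrite -[LHS]/(val (rho D)) /rho raddf_sum.
rewrite sum_lfunE (bigD1 i) //= rho_coroot eqxx big1.
  by rewrite addr0 scale1r.
by move=> j /negbTE ji; rewrite rho_coroot ji.
Qed.

Lemma act_alpha_neq0 w i : act w (alphaX D i) != 0.
Proof.
apply/eqP => /(congr1 (act w^-1%g)); rewrite -act_mul mulVg act1 raddf0.
move=> /(congr1 val) /= a0.
have /(free_not0 (alpha_free D)) : alpha D i \in [seq alpha D i | i <- enum 'I_r].
  by rewrite map_f ?mem_enum.
by rewrite a0 eqxx.
Qed.

Lemma e_D lam mu : e_ (lam + mu) = e_ lam * e_ mu.
Proof. by rewrite -[RHS]/(gmul _ _) gmulUU mulr1. Qed.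

Lemma e_eq1 lam : (e_ lam == 1) = (lam == 0).
Proof. by apply/eqP/eqP => [/gexp_inj|-> //]. Qed.

Lemma e_neq0 lam : e_ lam != 0.
Proof. by rewrite monalgU_eq0 oner_eq0. Qed.

Lemma bruhat_le_len u v : bruhat_le u v -> u = v :> weyl D \/ (len u < len v)%N.
Proof.
elim=> [x y [_ h]|x|x y z _ IH1 _ IH2]; [by right|by left|].
case: IH1 => [->//|l1]; right; case: IH2 => [<-//|]; exact: ltn_trans.
Qed.

Lemma bruhat_lt_mulsr u i : (len u < len (u * sr D i)%g)%N -> bruhat_lt u (u * sr D i)%g.
Proof.
move=> h; split; last by move=> e; rewrite -e ltnn in h.
by apply: rt_step; split=> //; exists 1%g, i; rewrite mul1g invg1 mulg1.
Qed.

Section Psi.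
Variables (psi : weyl D -> weyl D -> RT D) (hpsi : is_psi_family psi).

Lemma psi_diag_neq0 w : psi w w != 0.
Proof.
(* An infinite support makes the product 1 by default; otherwise a factor could vanish only at the
   weight 0, which is not a root. *)
rewrite (psi_diag hpsi); case: finite_supportP => [_|X XP _ _].
  by rewrite big_nil oner_neq0.
rewrite prodf_seq_neq0; apply/allP => b bX; apply/implyP => _.
rewrite subr_eq0 eq_sym e_eq1; apply/eqP => b0.
by have [[[]]] := XP _ bX; rewrite b0.
Qed.

Lemma psi_at1 w : psi w 1%g = (w == 1%g)%:R.
Proof.
case: eqP => [->|nw]; first by rewrite (psi_one hpsi) act1 subrr.
apply: (psi_support hpsi) => /bruhat_le_len[//|].
by have := @len_word _ _ _ D [::]; rewrite big_nil leqn0 => /eqP ->.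
Qed.

(** The denominator is cleared in the fraction field and the identity is brought back to R[T] by
    injectivity of the embedding. *)
Lemma demazureE f i v (g : RT D) :
  demazure i (fun v => toQ (f v)) v = toQ g ->
  f (v * sr D i)%g = e_ (act v (alphaX D i)) * (f v - g) + g.
Proof.
set b := act v (alphaX D i); rewrite /demazure -/b.
have n0 : toQ (1 - e_ (- b)) != 0 :> QT D.
  by rewrite /toQ tofrac_eq0 subr_eq0 eq_sym e_eq1 oppr_eq0 act_alpha_neq0.
rewrite -(tofrac1 (RT D)) -[X in _ / X]tofracB -tofracM -tofracB.
move/(canRL (divfK n0))/eqP; rewrite -[toQ g * _]tofracM tofrac_eq => /eqP e.
have e1 : e_ b * e_ (- b) = 1 by rewrite -e_D subrr.
exact: demazure_eq_solve e.
Qed.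


Lemma psi_mulsr_up w v i : (len w < len (w * sr D i)%g)%N ->
  psi w (v * sr D i)%g = e_ (act v (alphaX D i)) * psi w v.
Proof.
move=> /bruhat_lt_mulsr /(psi_demazure_gt hpsi) /(congr1 (fun f => f v)) h.
by rewrite (@demazureE _ i v 0) ?subr0 ?addr0 // h /toQ tofrac0.
Qed.

Lemma psi_mulsr_down w v i : (len (w * sr D i)%g < len w)%N ->
  psi w (v * sr D i)%g
    = psi w v + (1 - e_ (act v (alphaX D i))) * psi (w * sr D i)%g v.
Proof.
move=> lt; have lt' : bruhat_lt (w * sr D i)%g w.
  rewrite -[X in bruhat_lt _ X](mulgenK (@sr_invol _ _ _ D) w i).
  by apply: bruhat_lt_mulsr; rewrite (mulgenK (@sr_invol _ _ _ D)).
have := congr1 (fun f => f v) (psi_demazure_lt hpsi lt').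
rewrite /= -tofracD => /demazureE ->.
by ring.
Qed.

Local Notation wp s := (\prod_(i <- s) sr D i)%g.
Local Notation len := (@len R r A D).
Local Notation star := (star (sr D) len).
Local Notation dem := (dem (sr D) len).

Let gg := @sr_invol R r A D.
Let lP := @lenP R r A D.
Let lw := @len_word R r A D.
Let ol := @odd_len_mulsr R r A D.

(** At an ascent of [w] the last letter only contributes a unit and is left out. At a descent, one
    of two terms is nonzero: [psi w] leaves the letter out, [psi (w * sr D i)] appends it. *)
Lemma psi_neq0_subword s w :
  psi w (wp s) != 0 -> exists2 s', subseq s' s & dem s' = w.
Proof.
elim/last_ind: s w => [|s i IH] w.
  rewrite big_nil psi_at1; case: (eqVneq w 1%g) => [-> _|_]; last by rewrite eqxx.
  by exists [::].
rewrite big_rcons /=; case: (len_mulgen gg lP lw ol w i) => lwi.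
  rewrite psi_mulsr_up ?lwi // mulf_eq0 (negbTE (e_neq0 _)) /= => /IH[s' ss' es'].
  by exists s' => //; apply: subseq_trans ss' (subseq_rcons _ _).
have lt : (len (w * sr D i)%g < len w)%N by rewrite lwi.
rewrite psi_mulsr_down //.
have [->|/IH[s' ss' es'] _] := eqVneq (psi w (wp s)) 0; last first.
  by exists s' => //; apply: subseq_trans ss' (subseq_rcons _ _).
rewrite add0r mulf_eq0 negb_or => /andP[_ /IH[s' ss' es']].
exists (rcons s' i); first by rewrite -!cats1 cat_subseq.
by rewrite dem_rcons es' star_up (mulgenK gg).
Qed.

(* For [u < u * sr D i], [psi u (u * sr D i)] is a unit times [psi u u], hence
   does not vanish. *)
Lemma weyl_subword s u i : wp s = (u * sr D i)%g -> (len u < len (u * sr D i)%g)%N ->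
  exists2 s', subseq s' s & dem s' = u.
Proof.
move=> es lt; apply: psi_neq0_subword.
by rewrite es psi_mulsr_up // mulf_neq0 ?e_neq0 ?psi_diag_neq0.
Qed.

End Psi.
End Characters.

Lemma if_orb_mul (K : pzRingType) (p q1 q2 : bool) (x c : K) :
  p = q1 || q2 -> ~~ (q1 && q2) ->
  (if p then x * c else 0) = ((if q1 then x else 0) + (if q2 then x else 0)) * c.
Proof. by move=> ->; case: q1; case: q2; rewrite //= ?addr0 ?add0r ?mul0r. Qed.

(** The descent step of the final induction: [E] is the exponential prefactor, [c] that of
    [v' alpha_i], and [x], [y] are the subset sums of [w] and [w r_i]. *)
Lemma subset_sum_step (K : comPzRingType) (E c c' x y p q : K) : c * c' = 1 ->
  p = E * x -> q = E * y ->
  p + (1 - c) * q = E * c * (x + (x + y) * (c' - 1)).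
Proof.
move=> cc -> ->; have -> : E * c * (x + (x + y) * (c' - 1))
    = E * (c * c') * (x + y) - E * c * y by ring.
by rewrite cc; ring.
Qed.

(** * Subsets of [l.+1] indices, split by the last index *)

Section Subsets.
Variable l : nat.

Definition widen_set (K : {set 'I_l}) : {set 'I_l.+1} := widen_ord (leqnSn l) @: K.

Lemma widen_ord_inj : injective (widen_ord (leqnSn l)).
Proof. by move=> j k /(congr1 val) /= /val_inj. Qed.

Lemma ord_max_widen_set K : (ord_max \in widen_set K) = false.
Proof.
apply/negbTE/imsetP => -[j _ /(congr1 val) /= e].
by have := ltn_ord j; rewrite -e ltnn.
Qed.

Lemma big_set_ord_recr (V : zmodType) (F : {set 'I_l.+1} -> V) :
  \sum_J F J = \sum_K F (widen_set K) + \sum_K F (ord_max |: widen_set K).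
Proof.
(* [h'] forgets the last index and inverts both parametrizations. *)
pose h' (J : {set 'I_l.+1}) : {set 'I_l} := widen_ord (leqnSn l) @^-1: J.
have hK K : h' (widen_set K) = K.
  by apply/setP => j; rewrite inE mem_imset //; apply: widen_ord_inj.
have hK' K : h' (ord_max |: widen_set K) = K.
  rewrite -[RHS]hK; apply/setP => j; rewrite !inE.
  case: eqP => // /(congr1 val) /= e.
  by have := ltn_ord j; rewrite e ltnn.
have ordP (j : 'I_l.+1) : j != ord_max -> exists k, j = widen_ord (leqnSn l) k.
  move=> jm; have jl : (j < l)%N.
    rewrite ltn_neqAle -ltnS ltn_ord andbT.
    by apply: contra_neq jm => e; apply: val_inj.
  by exists (Ordinal jl); apply: val_inj.
have widenE (J : {set 'I_l.+1}) k :
    (widen_ord (leqnSn l) k \in widen_set (h' J)) = (widen_ord (leqnSn l) k \in J).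
  by rewrite mem_imset ?inE //; apply: widen_ord_inj.
rewrite (bigID (fun J : {set 'I_l.+1} => ord_max \in J)) /= addrC; congr (_ + _).
- rewrite (reindex_onto widen_set h').
    by apply: eq_bigl => K; rewrite hK eqxx ord_max_widen_set.
  move=> J mJ; apply/setP => j; have [->|/ordP[k ->]] := eqVneq j ord_max.
    by rewrite ord_max_widen_set (negbTE mJ).
  exact: widenE.
- rewrite (reindex_onto (fun K => ord_max |: widen_set K) h').
    by apply: eq_bigl => K; rewrite hK' eqxx setU11.
  move=> J mJ; apply/setP => j; rewrite in_setU1.
  by have [->|/ordP[k ->]] := eqVneq j ord_max; rewrite ?mJ //=.
Qed.

Variables (T : Type) (idx : T) (op : Monoid.law idx).

(** The law may be noncommutative, so the order of the factors is kept: membership becomes a neutral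
    factor and the last index is peeled off. *)
Lemma big_widen_set (F : 'I_l.+1 -> T) K :
  \big[op/idx]_(j in widen_set K) F j
    = \big[op/idx]_(j in K) F (widen_ord (leqnSn l) j).
Proof.
rewrite big_mkcond big_ord_recr /= ord_max_widen_set Monoid.mulm1.
rewrite [RHS]big_mkcond; apply: eq_bigr => j _.
by rewrite mem_imset //; apply: widen_ord_inj.
Qed.

Lemma big_setU_max (F : 'I_l.+1 -> T) K :
  \big[op/idx]_(j in ord_max |: widen_set K) F j
    = op (\big[op/idx]_(j in K) F (widen_ord (leqnSn l) j)) (F ord_max).
Proof.
rewrite big_mkcond big_ord_recr /= setU11; congr (op _ _).
rewrite [RHS]big_mkcond; apply: eq_bigr => j _.
rewrite in_setU1 mem_imset; last exact: widen_ord_inj.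
case: eqP => // /(congr1 val) /= e.
by have := ltn_ord j; rewrite e ltnn.
Qed.

End Subsets.

(** * Identification of the monoid with W *)

Section DemazureMonoid.
Variables (R : realType) (r : nat) (A : 'M[int]_r) (D : root_data R A).
Variables (psi : weyl D -> weyl D -> RT D) (hpsi : is_psi_family psi).
Implicit Types (u v w : weyl D) (s t : seq 'I_r) (i : 'I_r).

Local Notation wp s := (\prod_(i <- s) sr D i)%g.
Local Notation len := (@len R r A D).
Local Notation star := (star (sr D) len).
Local Notation dem := (dem (sr D) len).
Local Notation reduced := (reduced (sr D) len).

Let gg := @sr_invol R r A D.
Let lP := @lenP R r A D.
Let lw := @len_word R r A D.
Let ol := @odd_len_mulsr R r A D.
Let sw := weyl_subword hpsi.

Lemma uword_altr i j m : i != j -> is_ord (sr D i * sr D j)%g m ->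
  uword_eq D (altr m i j) (altr m j i).
Proof.
move=> ij om; have := uword_braid ij om.
by rewrite /alternating !alternatingE; case: odd => // /uword_sym.
Qed.

(** The monoid thus acts on W by [star]; acting on 1 recovers [w] from its class, whence
    [underline_inj]. *)
Lemma uword_eq_star s t w : uword_eq D s t -> foldl star w s = foldl star w t.
Proof.
move=> e; elim: e w => {s t} [//|s t _ IH|s t u _ IH1 _ IH2|s s' t t' _ IH1 _ IH2|i|i j m _ om] w.
- by rewrite IH.
- by rewrite IH1.
- by rewrite !foldl_cat IH1.
- by rewrite /= (starK _ gg).
- have := foldl_star_braid gg lP lw ol sw w om.
  by rewrite /alternating !alternatingE; case: odd.
Qed.

Lemma uword_eq_reduced s t : reduced t -> wp t = dem s -> uword_eq D s t.
Proof.
move=> rt e; apply: (congruent_dem gg lP lw ol sw) rt e.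
- exact: uword_refl.
- exact: uword_trans.
- by move=> *; apply: uword_cat.
- exact: uword_altr.
- exact: uword_idem.
Qed.

Lemma prod_ur s : (\prod_(i <- s) ur D i)%g = uclass D s.
Proof.
elim: s => [|i s IH]; first by rewrite big_nil.
by rewrite big_cons IH; apply: uweyl_mul_class.
Qed.

Lemma underlineP w : exists s, [/\ reduced s, wp s = w & underline w = uclass D s].
Proof.
rewrite /underline; set s := xchoose _.
have /eqP es : (wp s)%g == w := xchooseP (reduced_word_subproof w).
exists s; split=> //; last exact: prod_ur.
by rewrite /reduced es size_tuple.
Qed.

Lemma uclass_dem s : uclass D s = underline (dem s).
Proof.
have [t [rt et ->]] := underlineP (dem s).
by apply/uclassP/uword_eq_reduced.
Qed.

Lemma underline_inj : injective (@underline R r A D).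
Proof.
move=> u v; have [s [rs es ->]] := underlineP u; have [t [rt et ->]] := underlineP v.
move/uclassP/(uword_eq_star 1%g); rewrite -!/(dem _).
by rewrite !(reduced_dem lP lw) // es et.
Qed.

Lemma underline_mul_ur u i : (underline u * ur D i)%g = underline (star u i).
Proof.
have [s [rs es ->]] := underlineP u.
have -> : (uclass D s * ur D i)%g = uclass D (rcons s i).
  by rewrite -cats1; apply: uweyl_mul_class.
rewrite [LHS]uclass_dem; congr (underline _).
by rewrite dem_rcons (reduced_dem lP lw rs) es.
Qed.

Lemma underline_surj (x : uweyl D) : exists u, x = underline u.
Proof. by exists (dem (uword_of x)); rewrite -uclass_dem uword_ofK. Qed.

Lemma underline_eq u w : (underline u == underline w) = (u == w).
Proof. by apply/eqP/eqP => [/underline_inj|->]. Qed.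

Lemma underline_mul_ur_eq u w i : ((underline u * ur D i)%g == underline w) =
  (len (w * sr D i)%g < len w)%N && ((u == w) || (u == (w * sr D i)%g)).
Proof.
rewrite underline_mul_ur underline_eq; have [lt|lt] := boolP (len (w * sr D i)%g < len w)%N.
  exact: (star_eq_down gg).
by apply: (star_eq_up gg); rewrite (ltn_mulgen gg lP lw ol).
Qed.

(** * The subset sum and its recursion *)

(** The sum of the theorem before grouping by cardinality. The weights [b] are left free so that the
    recursion on [l] does not involve roots. *)
Definition subset_sum l (a : 'I_l -> 'I_r) (b : 'I_l -> RT D) w : RT D :=
  \sum_(J : {set 'I_l} | (\prod_(j in J) ur D (a j))%g == underline w)
    \prod_(j in J) b j.

(** A subset with the last index is a subset of the shorter word, of class [underline u], followed
    by one letter. It contributes only at a descent of [w], for [u] equal to [w] or [w r_i]. *)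
Lemma subset_sum_recr l (a : 'I_l.+1 -> 'I_r) (b : 'I_l.+1 -> RT D) w :
  let a' (j : 'I_l) := a (widen_ord (leqnSn l) j) in
  let b' (j : 'I_l) := b (widen_ord (leqnSn l) j) in
  subset_sum a b w = subset_sum a' b' w +
    (if (len (w * sr D (a ord_max))%g < len w)%N then
      (subset_sum a' b' w + subset_sum a' b' (w * sr D (a ord_max))%g) * b ord_max
     else 0).
Proof.
move=> a' b'; rewrite /subset_sum big_mkcond big_set_ord_recr; congr (_ + _).
  by rewrite [RHS]big_mkcond; apply: eq_bigr => K _; rewrite !big_widen_set.
under eq_bigr => K _ do rewrite !big_setU_max.
case: ifPn => lt.
  rewrite [X in (X + _) * _]big_mkcond [X in (_ + X) * _]big_mkcond -big_split /=.
  rewrite mulr_suml; apply: eq_bigr => K _.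
  have [u ->] := underline_surj (\prod_(j in K) ur D (a' j))%g.
  apply: if_orb_mul; last first.
    apply/negP => /andP[/eqP/underline_inj-> /eqP/underline_inj e].
    by rewrite -e ltnn in lt.
  rewrite [LHS]underline_mul_ur_eq lt /=.
  by congr (_ || _); apply/esym/underline_eq.
rewrite big1 // => K _.
have [u ->] := underline_surj (\prod_(j in K) ur D (a' j))%g.
have := underline_mul_ur_eq u w (a ord_max); rewrite (negbTE lt) /= => e.
by rewrite ifF.
Qed.

Lemma prod_prefix_max l (f : 'I_l.+1 -> weyl D) :
  (\prod_(k < l.+1 | (k < l)%N) f k = \prod_(k < l) f (widen_ord (leqnSn l) k))%g.
Proof.
rewrite big_mkcond big_ord_recr /= ltnn mulg1.
by apply: eq_bigr => k _; rewrite ltn_ord.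
Qed.

Lemma prod_prefix_widen l (f : 'I_l.+1 -> weyl D) (j : 'I_l) :
  (\prod_(k < l.+1 | (k < j)%N) f k
    = \prod_(k < l | (k < j)%N) f (widen_ord (leqnSn l) k))%g.
Proof.
by rewrite big_mkcond big_ord_recr /= ltnNge (ltnW (ltn_ord j)) mulg1 -big_mkcond.
Qed.

Lemma subset_sum0 (a : 'I_0 -> 'I_r) (b : 'I_0 -> RT D) w :
  subset_sum a b w = (w == 1%g)%:R.
Proof.
have e1 : underline 1%g = 1%g :> uweyl D.
  by rewrite -[1%g in LHS]/(dem [::]) -uclass_dem.
have J0 (J : {set 'I_0}) : J = finset.set0 by apply/setP => -[].
rewrite /subset_sum big_mkcond (bigD1 finset.set0) //= [X in _ + X]big1 ?addr0 => [|J].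
  by rewrite !big_set0 -e1 (underline_eq 1%g w) eq_sym; case: (w == _).
by rewrite (J0 J) eqxx.
Qed.

(** Induction on [l] for all [w] at once, since a descent calls on both [w] and [w r_i]. *)
Lemma psi_subset_sum l (a : 'I_l -> 'I_r) (b : 'I_l -> RT D) w :
  (forall j : 'I_l, b j =
    e_ (- act (\prod_(k < l | (k < j)%N) sr D (a k))%g (alphaX D (a j))) - 1) ->
  let v := (\prod_(j < l) sr D (a j))%g in
  psi w v = e_ (rho D - act v (rho D)) * subset_sum a b w.
Proof.
elim: l a b w => [|l IH] a b w hb v; rewrite {}/v.
  by rewrite big_ord0 (psi_at1 hpsi) act1 subrr subset_sum0 mul1r.
have hb' (j : 'I_l) : b (widen_ord (leqnSn l) j) =
    e_ (- act (\prod_(k < l | (k < j)%N) sr D (a (widen_ord (leqnSn l) k)))%g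
               (alphaX D (a (widen_ord (leqnSn l) j)))) - 1.
  by rewrite hb prod_prefix_widen.
have {IH hb'}IH u := IH _ _ u hb'.
have bm := hb ord_max; rewrite /= prod_prefix_max in bm.
rewrite subset_sum_recr {}bm big_ord_recr /=; move: (a ord_max) => i.
move: (\prod_(j < l) _)%g IH => v' IH.
(* The prefactor gains the exponential of [v' alpha_i] because r_i rho = rho - alpha_i. *)
have -> : e_ (rho D - act (v' * sr D i)%g (rho D))
    = e_ (rho D - act v' (rho D)) * e_ (act v' (alphaX D i)).
  by rewrite act_mul act_sr_rho raddfB opprB addrCA addrC -e_D.
case: ifPn => lt.
  rewrite (psi_mulsr_down hpsi) //; apply: subset_sum_step (IH _) (IH _).
  by rewrite -e_D subrr.
rewrite addr0 [RHS]mulrAC -IH [RHS]mulrC; apply: (psi_mulsr_up hpsi).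
by rewrite (ltn_mulgen gg lP lw ol).
Qed.

(** A Demazure product is no longer than its word; this accounts for the lower bound on [m] in the
    theorem. *)
Lemma len_le_card l (a : 'I_l -> 'I_r) (J : {set 'I_l}) w :
  (\prod_(j in J) ur D (a j))%g = underline w -> (len w <= #|J|)%N.
Proof.
rewrite -big_filter; have [e _ _ [_ se]] := big_enumP.
have -> : #|J| = size e by rewrite se; apply: eq_card.
rewrite -(big_map a xpredT (ur D)) prod_ur uclass_dem => /underline_inj <-.
by rewrite -(size_map a); apply: (len_dem lP lw ol).
Qed.

End DemazureMonoid.

Theorem mainTheorem1 (R : realType) (r : nat) (A : 'M[int]_r) (D : root_data R A)
    (psi : weyl D -> weyl D -> RT D) (hpsi : is_psi_family psi)
    (v : weyl D) (l : nat) (i : 'I_l -> 'I_r)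
    (hv : v = (\prod_(j < l) sr D (i j))%g) (hl : l = len v)
    (beta : 'I_l -> charlat D)
    (hbeta : forall j : 'I_l,
       beta j = act (\prod_(k < l | (k < j)%N) sr D (i k))%g (alphaX D (i j)))
    (w : weyl D) (hw : bruhat_le w v) :
  psi w v =
    e_ (rho D - act v (rho D)) *
    \sum_(len w <= m < (len v).+1)
      \sum_(J : {set 'I_l} | (#|J| == m) &&
              ((\prod_(j in J) ur D (i j))%g == underline w))
        \prod_(j in J) (e_ (- beta j) - 1).
Proof.
have hb (j : 'I_l) : e_ (- beta j) - 1 =
    e_ (- act (\prod_(k < l | (k < j)%N) sr D (i k))%g (alphaX D (i j))) - 1.
  by rewrite hbeta.
have := psi_subset_sum hpsi w hb; rewrite /= -hv => ->; congr (_ * _).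
(* After the exchange, each admissible [J] is counted once, at [m = #|J|], which lies between
   [len w] and [l = len v]. *)
rewrite (exchange_big_dep
  (fun J : {set 'I_l} => (\prod_(j in J) ur D (i j))%g == underline w)) /=.
  rewrite /subset_sum; apply: eq_bigr => J PJ; rewrite PJ [RHS]big_mkcond.
  rewrite [RHS](bigD1_seq #|J|) ?iota_uniq //=; last first.
    rewrite mem_index_iota ltnS -hl (len_le_card hpsi (eqP PJ)).
    by rewrite -[X in (_ <= X)%N]card_ord max_card.
  rewrite eqxx [X in _ = _ + X]big1 ?addr0 // => m /negbTE mJ.
  by rewrite eq_sym mJ.
by move=> m J _ /andP[].
Qed.
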